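(* For every integer $p\ge0$, $$\sum_{k=1}^\infty\frac{(-1)^{k-1}}{(4k-1)(4k)^{2p+1}(4k+1)}=\frac12+\frac{\sqrt2}{4}\ln(\sqrt2-1)-\frac14\ln 2-\frac14\sum_{j=1}^p\frac{1-2^{-2j}}{2^{4j}}\zeta(2j+1),$$ $$\sum_{k=1}^\infty\frac{(-1)^{k-1}}{(4k-3)(4k-2)^{2p+1}(4k-1)}=\frac{\pi}{8}(\sqrt2-1)-\frac12\sum_{j=1}^p\frac{(-1)^{j+1}\pi^{2j+1}}{(2j+1)!}B_{2j+1}(1/4).$$
   Context: $\zeta$ is the Riemann zeta function; $B_n(y)$ are the Bernoulli polynomials, defined by $\frac{te^{yt}}{e^t-1}=\sum_{k\ge0}B_k(y)\frac{t^k}{k!}$. Empty sums are $0$. *)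

(* Defs.v *)
From Stdlib Require Import Reals.
From Coquelicot Require Import Coquelicot.
Open Scope R_scope.

Definition zeta (s : nat) : R := Series (fun n => / (INR (S n)) ^ s).

(* The generating function t e^{yt}/(e^t - 1), extended by continuity
   (value 1) at t = 0. *)
Definition bernoulli_gf (y : R) (t : R) : R :=
  if Req_EM_T t 0 then 1 else t * exp (y * t) / (exp t - 1).

(* Bernoulli polynomials: B_n(y) is n! times the t^n Taylor coefficient of
   the generating function, i.e. its n-th derivative at t = 0. *)
Definition bernoulli_poly (n : nat) (y : R) : R :=
  Derive_n (bernoulli_gf y) n 0.

(* Main.v *)
(* Since [1/(x^(2p+1)(x^2-1)) = 1/(x^(2p-1)(x^2-1)) - 1/x^(2p+1)], each sum with exponent
   [2p+1] is its case [p = 0] minus alternating sums of inverse odd powers.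

   For [p = 0], partial fractions make the general term the integral over [0,1] of
   [(-x^4)^n g(x)] with [g] a polynomial, so the sum is the integral of [g(x)/(1+x^4)].

   Over multiples of 4 the alternating power sums are values of the eta function, hence of
   zeta. Over [4k-2] they are values of Dirichlet's beta function at odd integers, which are
   the Taylor coefficients of [sum_k (-1)^k m/(m^2+t^2) = (PI/4) / cosh (PI t/2)], [m = 2k+1].
   The odd part of [t e^(t/4)/(e^t-1)] is [-(t/4) / cosh (t/4)], so these coefficients are
   also the Taylor coefficients that define [B_(2p+1)(1/4)]. *)
Require Import Defs.
From Stdlib Require Import Reals Lra Lia FunctionalExtensionality.
From Coquelicot Require Import Coquelicot.
Open Scope R_scope.

(* [ring] and [field] reject goals whose equality is at a Coquelicot carrier that is only
   convertible to [R]. *)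
Ltac as_real_eq := lazymatch goal with |- @eq _ ?a ?b => change (@eq R a b) end.

(** * Estimates through derivatives and termwise integration *)

(** Stands in for bounding an integral of [f'] by an integral of [g'], with no integrability to
    check. The mean value theorem applied to [g - s * f] gives [s * (f b - f a) <= g b - g a]
    whenever [Rabs s <= 1]; then take [s = 1] and [s = -1]. *)
Lemma increment_le (f f' g g' : R -> R) (a b : R) :
  a <= b ->
  (forall x, a <= x <= b -> is_derive f x (f' x)) ->
  (forall x, a <= x <= b -> is_derive g x (g' x)) ->
  (forall x, a <= x <= b -> Rabs (f' x) <= g' x) ->
  Rabs (f b - f a) <= g b - g a.
Proof.
  intros Hab Hf Hg Hle.
  assert (H : forall s, Rabs s <= 1 -> s * (f b - f a) <= g b - g a).
  { intros s Hs.
    destruct (MVT_gen (fun x => g x - s * f x) a b (fun x => g' x - s * f' x))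
      as [c [Hc E]].
    - intros x Hx. rewrite Rmin_left, Rmax_right in Hx by lra.
      apply (is_derive_minus g (fun x => s * f x)).
      + apply Hg; lra.
      + apply (is_derive_scal f). apply Hf; lra.
    - intros x Hx. rewrite Rmin_left, Rmax_right in Hx by lra.
      apply derivable_continuous_pt. exists (g' x - s * f' x).
      apply is_derive_Reals.
      apply (is_derive_minus g (fun x => s * f x)).
      + apply Hg; lra.
      + apply (is_derive_scal f). apply Hf; lra.
    - rewrite Rmin_left, Rmax_right in Hc by lra.
      assert (s * f' c <= g' c).
      { eapply Rle_trans; [apply Rle_abs|]. rewrite Rabs_mult.
        specialize (Hle c Hc). pose proof (Rabs_pos (f' c)). nra. }
      simpl in E. nra. }
  apply Rabs_le.
  assert (H1 := H 1). assert (H2 := H (-1)).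
  rewrite Rabs_R1 in H1. rewrite (Rabs_left (-1)) in H2 by lra. lra.
Qed.

Lemma sum_n_geom_opp (z : R) (N : nat) :
  1 + z <> 0 ->
  sum_n (fun n => (-1) ^ n * z ^ n) N = (1 - (-1) ^ S N * z ^ S N) / (1 + z).
Proof.
  intros Hz. induction N as [|N IH].
  - rewrite sum_O. simpl. field. exact Hz.
  - rewrite sum_Sn, IH. unfold plus; simpl. field. exact Hz.
Qed.

Lemma is_lim_seq_of_bound (u : nat -> R) (l C : R) :
  (forall n, Rabs (u n - l) <= C / INR (S n)) -> is_lim_seq u l.
Proof.
  intros H.
  assert (L : is_lim_seq (fun n => C / INR (S n)) 0).
  { replace (Finite 0) with (Rbar_mult C 0) by (simpl; f_equal; ring).
    apply is_lim_seq_scal_l.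
    apply (is_lim_seq_incr_1 (fun n => / INR n)).
    replace (Finite 0) with (Rbar_inv p_infty) by reflexivity.
    apply is_lim_seq_inv; [apply is_lim_seq_INR | discriminate]. }
  apply (is_lim_seq_ext (fun n => (u n - l) + l)); [intros; ring|].
  replace (Finite l) with (Rbar_plus 0 l) by (simpl; f_equal; ring).
  apply is_lim_seq_plus'; [|apply is_lim_seq_const].
  apply is_lim_seq_abs_0.
  apply (is_lim_seq_le_le (fun _ => 0) _ (fun n => C / INR (S n)));
    [|apply is_lim_seq_const | exact L].
  intros n; split; [apply Rabs_pos | apply H].
Qed.

Lemma is_derive_sum_n (f f' : nat -> R -> R) (N : nat) (x : R) :
  (forall n, is_derive (f n) x (f' n x)) ->
  is_derive (fun y => sum_n (fun n => f n y) N) x (sum_n (fun n => f' n x) N).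
Proof.
  intros H. induction N as [|N IH].
  - rewrite sum_O. apply (is_derive_ext (f O)); [|apply H].
    intros; now rewrite sum_O.
  - rewrite sum_Sn.
    apply (is_derive_ext (fun y => plus (sum_n (fun n => f n y) N) (f (S N) y))).
    + intros; now rewrite sum_Sn.
    + apply (is_derive_plus (V:=R_NormedModule)); [exact IH | apply H].
Qed.

(** Termwise integration of [g x / (1 + x ^ 4)] over [0,1]. The geometric remainder does not tend to
    0 uniformly near [x = 1], but it is at most [M * x ^ (4 * N + 4)], hence at most [M * x ^ N],
    whose integral [M / INR (S N)] does tend to 0. *)
Lemma is_series_of_primitive (g F : R -> R) (G : nat -> R -> R) (M : R) :
  (forall x, 0 <= x <= 1 -> Rabs (g x) <= M) ->
  (forall x, 0 <= x <= 1 -> is_derive F x (g x / (1 + x ^ 4))) ->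
  (forall n x, is_derive (G n) x (x ^ (4 * n) * g x)) ->
  is_series (fun n => (-1) ^ n * (G n 1 - G n 0)) (F 1 - F 0).
Proof.
  intros Hg HF HG.
  apply (is_lim_seq_of_bound _ _ M). intros N.
  set (S_ := fun x => sum_n (fun n => (-1) ^ n * G n x) N).
  assert (E : sum_n (fun n => (-1) ^ n * (G n 1 - G n 0)) N = S_ 1 - S_ 0).
  { unfold S_. clear. induction N as [|N IH].
    - rewrite !sum_O. simpl; ring.
    - rewrite !sum_Sn, IH. unfold plus; simpl. ring. }
  enough (B : Rabs (S_ 1 - S_ 0 - (F 1 - F 0)) <= M / INR (S N))
    by (rewrite <- E in B; exact B).
  assert (HM : 0 <= M) by (eapply Rle_trans; [apply Rabs_pos | apply (Hg 0); lra]).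
  assert (HN : 0 < INR (S N)) by (apply lt_0_INR; lia).
  assert (B := increment_le (fun x => S_ x - F x)
    (fun x => sum_n (fun n => (-1) ^ n * (x ^ (4 * n) * g x)) N - g x / (1 + x ^ 4))
    (fun x => M / INR (S N) * x ^ S N)
    (fun x => M * x ^ N) 0 1 ltac:(lra)).
  replace (S_ 1 - S_ 0 - (F 1 - F 0)) with (S_ 1 - F 1 - (S_ 0 - F 0)) by ring.
  eapply Rle_trans; [apply B|].
  - intros x Hx. apply (is_derive_minus S_ F); [|apply HF, Hx].
    apply (is_derive_sum_n (fun n x => (-1) ^ n * G n x)
      (fun n x => (-1) ^ n * (x ^ (4 * n) * g x))).
    intros n. apply (is_derive_scal (G n)), HG.
  - intros x _. auto_derive; [easy|].
    change (M / INR (S N) * (1 * (INR (S N) * x ^ N)) = M * x ^ N). field. lra.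
  - intros x Hx.
    assert (Hx4 : 0 <= x ^ 4) by (apply pow_le; lra).
    replace (sum_n (fun n => (-1) ^ n * (x ^ (4 * n) * g x)) N)
      with (g x * sum_n (fun n => (-1) ^ n * (x ^ 4) ^ n) N).
    2:{ rewrite <- (sum_n_mult_l (K:=R_Ring)). apply sum_n_ext. intros n.
        rewrite pow_mult. unfold mult; simpl. ring. }
    rewrite sum_n_geom_opp by lra.
    replace (g x * _ - _)
      with (g x * ((-1) ^ N * (x ^ 4) ^ S N / (1 + x ^ 4)))
      by (simpl; field; simpl in Hx4; lra).
    rewrite Rabs_mult. apply Rmult_le_compat; try apply Rabs_pos; [apply Hg, Hx|].
    unfold Rdiv. rewrite !Rabs_mult, pow_1_abs, Rmult_1_l.
    rewrite <- pow_mult, (Rabs_right (x ^ (4 * S N))) by (apply Rle_ge, pow_le; lra).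
    rewrite Rabs_inv, (Rabs_right (1 + x ^ 4)) by lra.
    apply Rle_trans with (x ^ (4 * S N)).
    + rewrite <- (Rmult_1_r (x ^ (4 * S N))) at 2.
      apply Rmult_le_compat_l; [apply pow_le; lra|].
      rewrite <- Rinv_1. apply Rinv_le_contravar; lra.
    + replace (4 * S N)%nat with (N + (3 * N + 4))%nat by lia.
      rewrite pow_add. rewrite <- (Rmult_1_r (x ^ N)) at 2.
      apply Rmult_le_compat_l; [apply pow_le; lra|].
      rewrite <- (pow1 (3 * N + 4)). apply pow_incr; lra.
  - rewrite pow1, pow_i by lia. lra.
Qed.

(** Induction on [p]: dividing [1 / (x ^ 2 - 1) = x ^ 2 / (x ^ 2 - 1) - 1] by [x ^ (2 * p + 3)]
    shows that raising [p] by one subtracts exactly the series with sum [b (S p)]. *)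
Lemma is_series_pow_reduction (x b : nat -> R) (s : R) :
  (forall n, 1 < x n) ->
  is_series (fun n => (-1) ^ n / ((x n - 1) * x n * (x n + 1))) s ->
  (forall j, (1 <= j)%nat -> is_series (fun n => (-1) ^ n / x n ^ (2 * j + 1)) (b j)) ->
  forall p, is_series (fun n => (-1) ^ n / ((x n - 1) * x n ^ (2 * p + 1) * (x n + 1)))
              (s - sum_n_m b 1 p).
Proof.
  intros Hx Hs Hb. induction p as [|p IH].
  - rewrite sum_n_m_zero by lia.
    replace (s - zero) with s by (unfold zero; simpl; ring).
    revert Hs. apply is_series_ext. intros n. simpl. now rewrite Rmult_1_r.
  - rewrite sum_n_Sm by lia.
    replace (s - plus (sum_n_m b 1 p) (b (S p)))
      with ((s - sum_n_m b 1 p) - b (S p)) by (unfold plus; simpl; ring).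
    assert (H := is_series_minus _ _ _ _ IH (Hb (S p) ltac:(lia))).
    revert H. apply is_series_ext. intros n. specialize (Hx n).
    replace (2 * S p + 1)%nat with (2 + (2 * p + 1))%nat by lia.
    rewrite (pow_add _ 2 (2 * p + 1)).
    assert (Hp : x n ^ (2 * p + 1) <> 0) by (apply pow_nonzero; lra).
    revert Hp. generalize (x n ^ (2 * p + 1)). intros y Hy.
    unfold minus, plus, opp; simpl.
    field. repeat split; lra.
Qed.

Lemma is_derive_pow_div (n : nat) (x : R) :
  is_derive (fun y => y ^ S n / INR (S n)) x (x ^ n).
Proof.
  assert (HN : 0 < INR (S n)) by (apply lt_0_INR; lia).
  auto_derive; [easy|].
  change (1 * (INR (S n) * x ^ n) * / INR (S n) = x ^ n). field. lra.
Qed.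

(** * Closed forms for p = 0 and Leibniz's series *)

Lemma sqrt_2_sqr : sqrt 2 ^ 2 = 2.
Proof. apply pow2_sqrt; lra. Qed.

Lemma sqrt_2_bounds : 1.4 < sqrt 2 < 1.5.
Proof.
  pose proof sqrt_2_sqr. pose proof (sqrt_pos 2). split; nra.
Qed.

(** Difference of squares: [1 + x ^ 4 = (x ^ 2 + 1) ^ 2 - 2 * x ^ 2]. The two quadratics produce the
    logarithms and arctangents of the closed forms. *)
Lemma one_plus_pow4_factor (x : R) :
  1 + x ^ 4 = (x ^ 2 - sqrt 2 * x + 1) * (x ^ 2 + sqrt 2 * x + 1).
Proof.
  replace ((x ^ 2 - sqrt 2 * x + 1) * (x ^ 2 + sqrt 2 * x + 1))
    with (x ^ 4 + (2 - sqrt 2 ^ 2) * x ^ 2 + 1) by ring.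
  rewrite sqrt_2_sqr. ring.
Qed.

Lemma quad_sqrt2_pos (x : R) :
  0 < x ^ 2 - sqrt 2 * x + 1 /\ 0 < x ^ 2 + sqrt 2 * x + 1.
Proof.
  pose proof sqrt_2_sqr. split.
  - replace (x ^ 2 - sqrt 2 * x + 1) with ((x - sqrt 2 / 2) ^ 2 + (1 - sqrt 2 ^ 2 / 4)) by field.
    pose proof (pow2_ge_0 (x - sqrt 2 / 2)). lra.
  - replace (x ^ 2 + sqrt 2 * x + 1) with ((x + sqrt 2 / 2) ^ 2 + (1 - sqrt 2 ^ 2 / 4)) by field.
    pose proof (pow2_ge_0 (x + sqrt 2 / 2)). lra.
Qed.

Lemma is_series_4k :
  is_series (fun n => let x := 4 * INR (S n) in (-1) ^ n / ((x - 1) * x * (x + 1)))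
    (1 / 2 + sqrt 2 / 4 * ln (sqrt 2 - 1) - 1 / 4 * ln 2).
Proof.
  pose proof sqrt_2_sqr as H2. pose proof sqrt_2_bounds as H3.
  (* With [x = 4 * INR (S n)], the partial fractions [/2 / (x - 1) - 1 / x + /2 / (x + 1)] are the
     integrals of [x ^ (4 * n)] times [/2 * x ^ 2 - x ^ 3 + /2 * x ^ 4]. Divided by [1 + x ^ 4],
     this polynomial is [/2 - x ^ 3 / (1 + x ^ 4) + (x ^ 2 - 1) / (2 * (1 + x ^ 4))], and [F]
     integrates the three pieces in turn. *)
  set (F := fun x => x / 2 - / 4 * ln (1 + x ^ 4)
    + sqrt 2 / 8 * (ln (x ^ 2 - sqrt 2 * x + 1) - ln (x ^ 2 + sqrt 2 * x + 1))).
  set (G := fun n x => / 2 * (x ^ S (4 * n + 2) / INR (S (4 * n + 2)))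
    - x ^ S (4 * n + 3) / INR (S (4 * n + 3))
    + / 2 * (x ^ S (4 * n + 4) / INR (S (4 * n + 4)))).
  replace (1 / 2 + _ - _) with (F 1 - F 0).
  - eapply is_series_ext;
      [|apply (is_series_of_primitive (fun x => / 2 * x ^ 2 - x ^ 3 + / 2 * x ^ 4) F G 1)].
    + intros n. unfold G. rewrite !pow1, !pow_i by lia.
      rewrite !S_INR, !plus_INR, !mult_INR. simpl.
      pose proof (pos_INR n). field. repeat split; lra.
    + intros x Hx.
      replace (/ 2 * x ^ 2 - x ^ 3 + / 2 * x ^ 4) with (/ 2 * (x * (1 - x)) ^ 2) by field.
      rewrite Rabs_right.
      * assert (0 <= x * (1 - x) <= 1) by nra. nra.
      * apply Rle_ge. pose proof (pow2_ge_0 (x * (1 - x))). lra.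
    + intros x _. destruct (quad_sqrt2_pos x) as [P1 P2].
      assert (P3 := one_plus_pow4_factor x).
      assert (P4 : 0 < 1 + x ^ 4) by (rewrite P3; now apply Rmult_lt_0_compat).
      unfold F. auto_derive.
      { simpl in *. repeat split; lra. }
      assert (E : sqrt 2 / 8 * ((2 * x - sqrt 2) / (x ^ 2 - sqrt 2 * x + 1)
          - (2 * x + sqrt 2) / (x ^ 2 + sqrt 2 * x + 1))
        = 2 / 4 * (x ^ 2 - 1) / (1 + x ^ 4)).
      { rewrite P3. transitivity (sqrt 2 ^ 2 / 4 * (x ^ 2 - 1)
          / ((x ^ 2 - sqrt 2 * x + 1) * (x ^ 2 + sqrt 2 * x + 1))).
        - field. split; lra.
        - now rewrite H2. }
      transitivity (/ 2 - x ^ 3 / (1 + x ^ 4)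
        + sqrt 2 / 8 * ((2 * x - sqrt 2) / (x ^ 2 - sqrt 2 * x + 1)
          - (2 * x + sqrt 2) / (x ^ 2 + sqrt 2 * x + 1))).
      { field. simpl in *. repeat split; lra. }
      rewrite E. field. lra.
    + intros n x. unfold G.
      replace (x ^ (4 * n) * _)
        with (/ 2 * x ^ (4 * n + 2) - x ^ (4 * n + 3) + / 2 * x ^ (4 * n + 4))
        by (rewrite !pow_add; ring).
      apply (is_derive_plus (V:=R_NormedModule)); [apply (is_derive_minus (V:=R_NormedModule))|].
      * apply is_derive_scal, is_derive_pow_div.
      * apply is_derive_pow_div.
      * apply is_derive_scal, is_derive_pow_div.
  - unfold F.
    replace (1 + 0 ^ 4) with 1 by ring. replace (1 + 1 ^ 4) with 2 by ring.
    replace (0 ^ 2 - sqrt 2 * 0 + 1) with 1 by ring.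
    replace (0 ^ 2 + sqrt 2 * 0 + 1) with 1 by ring.
    rewrite ln_1.
    (* The quadratics at 1 are [2 - sqrt 2] and [2 + sqrt 2]. In this form the [ln (sqrt 2)] cancels
       and their logarithms differ by [2 * ln (sqrt 2 - 1)]. *)
    replace (1 ^ 2 - sqrt 2 * 1 + 1) with (sqrt 2 * (sqrt 2 - 1)) by (ring_simplify; lra).
    replace (1 ^ 2 + sqrt 2 * 1 + 1) with (sqrt 2 * / (sqrt 2 - 1)).
    + rewrite !ln_mult, ln_Rinv by (try apply Rinv_0_lt_compat; lra). field.
    + apply Rmult_eq_reg_r with (sqrt 2 - 1); [|lra].
      rewrite Rmult_assoc, Rinv_l by lra. ring_simplify. lra.
Qed.

(** The substitution [x ^ 2] in the arctangent integral gives the integrand [2 * x / (1 + x ^ 4)],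
    so the termwise integration above applies: [2 * x ^ (4 * n + 1)] integrates to
    [1 / (2 * n + 1)]. *)
Lemma is_series_leibniz : is_series (fun n => (-1) ^ n / (2 * INR n + 1)) (PI / 4).
Proof.
  set (F := fun x => atan (x ^ 2)).
  set (G := fun n x => 2 * (x ^ S (4 * n + 1) / INR (S (4 * n + 1)))).
  replace (PI / 4) with (F 1 - F 0).
  - eapply is_series_ext; [|apply (is_series_of_primitive (fun x => 2 * x) F G 2)].
    + intros n. unfold G. rewrite pow1, pow_i by lia.
      rewrite S_INR, plus_INR, mult_INR. simpl. pose proof (pos_INR n). field. lra.
    + intros x Hx. rewrite Rabs_right; lra.
    + intros x _. unfold F.
      assert (0 <= x ^ 4) by (replace (x ^ 4) with ((x ^ 2) ^ 2) by ring; apply pow2_ge_0).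
      auto_derive; [easy|]. field. simpl in *; lra.
    + intros n x. unfold G.
      replace (x ^ (4 * n) * _) with (2 * x ^ (4 * n + 1)) by (rewrite pow_add; ring).
      apply is_derive_scal, is_derive_pow_div.
  - unfold F. rewrite pow1, pow_i, atan_0, atan_1 by lia. lra.
Qed.

Lemma is_series_4k2 :
  is_series (fun n => let x := 4 * INR (S n) - 2 in (-1) ^ n / ((x - 1) * x * (x + 1)))
    (PI / 8 * (sqrt 2 - 1)).
Proof.
  pose proof sqrt_2_sqr as H2. pose proof sqrt_2_bounds as H3.
  (* Here [x - 1], [x], [x + 1] are [4 * n + 1], [4 * n + 2], [4 * n + 3], so the polynomial is
     [/2 * (1 - x) ^ 2]. Over [1 + x ^ 4] it splits into [(1 + x ^ 2) / (2 * (1 + x ^ 4))], which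
     gives the first two arctangents, and [- x / (1 + x ^ 4)], which gives the last. *)
  set (F := fun x => sqrt 2 / 4 * (atan (sqrt 2 * x + 1) + atan (sqrt 2 * x - 1))
    - / 2 * atan (x ^ 2)).
  set (G := fun n x => / 2 * (x ^ S (4 * n) / INR (S (4 * n)))
    - x ^ S (4 * n + 1) / INR (S (4 * n + 1))
    + / 2 * (x ^ S (4 * n + 2) / INR (S (4 * n + 2)))).
  replace (PI / 8 * _) with (F 1 - F 0).
  - eapply is_series_ext;
      [|apply (is_series_of_primitive (fun x => / 2 * (1 - x) ^ 2) F G 1)].
    + intros n. unfold G. rewrite !pow1, !pow_i by lia.
      rewrite !S_INR, !plus_INR, !mult_INR. simpl.
      pose proof (pos_INR n). field. repeat split; lra.
    + intros x Hx.
      rewrite Rabs_right; [nra|].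
      apply Rle_ge. pose proof (pow2_ge_0 (1 - x)). lra.
    + intros x _. destruct (quad_sqrt2_pos x) as [P1 P2].
      assert (P3 := one_plus_pow4_factor x).
      unfold F. auto_derive; [easy|].
      assert (E1 : 1 + (sqrt 2 * x + 1) ^ 2 = 2 * (x ^ 2 + sqrt 2 * x + 1)).
      { transitivity (sqrt 2 ^ 2 * x ^ 2 + 2 * sqrt 2 * x + 2); [ring|].
        rewrite H2. ring. }
      assert (E2 : 1 + (sqrt 2 * x - 1) ^ 2 = 2 * (x ^ 2 - sqrt 2 * x + 1)).
      { transitivity (sqrt 2 ^ 2 * x ^ 2 - 2 * sqrt 2 * x + 2); [ring|].
        rewrite H2. ring. }
      transitivity (sqrt 2 ^ 2 / 4 * (/ (1 + (sqrt 2 * x + 1) ^ 2)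
        + / (1 + (sqrt 2 * x - 1) ^ 2)) - x / (1 + x ^ 4)).
      { field. rewrite P3. simpl in *. repeat split; nra. }
      rewrite E1, E2, H2, P3. field. split; lra.
    + intros n x. unfold G.
      replace (x ^ (4 * n) * _)
        with (/ 2 * x ^ (4 * n) - x ^ (4 * n + 1) + / 2 * x ^ (4 * n + 2))
        by (rewrite !pow_add; field).
      apply (is_derive_plus (V:=R_NormedModule)); [apply (is_derive_minus (V:=R_NormedModule))|].
      * apply is_derive_scal, is_derive_pow_div.
      * apply is_derive_pow_div.
      * apply is_derive_scal, is_derive_pow_div.
  - unfold F. rewrite !Rmult_0_r, !Rmult_1_r, pow1, pow_i, atan_0, atan_1 by lia.
    rewrite Rplus_0_l, Rminus_0_l, atan_opp, atan_1.
    (* The arctangents of the reciprocals [sqrt 2 + 1] and [sqrt 2 - 1] add up to [PI / 2]. *)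
    replace (sqrt 2 + 1) with (/ (sqrt 2 - 1)).
    + rewrite atan_inv by lra. field.
    + apply Rmult_eq_reg_r with (sqrt 2 - 1); [|lra].
      rewrite Rinv_l by lra. ring_simplify. lra.
Qed.

(** * Convergence of power sums and the eta function *)

(** Comparison with twice the telescoping series of [1 / ((n + 1) * (n + 2))]. *)
Lemma ex_series_inv_pow (s : nat) : (2 <= s)%nat -> ex_series (fun n => / INR (S n) ^ s).
Proof.
  intros Hs.
  assert (T : is_series (fun n => / (INR (S n) * INR (S (S n)))) 1).
  { apply (is_lim_seq_of_bound _ _ 1). intros N.
    assert (E : sum_n (fun n => / (INR (S n) * INR (S (S n)))) N = 1 - / INR (S (S N))).
    { induction N as [|N IH].
      - rewrite sum_O. simpl. field.
      - rewrite sum_Sn, IH. unfold plus. simpl AbelianMonoid.sort.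
        change (1 - / INR (S (S N)) + / (INR (S (S N)) * INR (S (S (S N))))
          = 1 - / INR (S (S (S N)))).
        rewrite (S_INR (S (S N))). pose proof (lt_0_INR (S (S N)) ltac:(lia)).
        field. lra. }
    enough (B : Rabs (1 - / INR (S (S N)) - 1) <= 1 / INR (S N)) by (rewrite <- E in B; exact B).
    pose proof (lt_0_INR (S N) ltac:(lia)).
    replace (1 - / INR (S (S N)) - 1) with (- / INR (S (S N))) by ring.
    rewrite Rabs_Ropp, Rabs_right.
    - unfold Rdiv. rewrite Rmult_1_l. apply Rinv_le_contravar; [easy|].
      rewrite (S_INR (S N)). lra.
    - apply Rle_ge, Rlt_le, Rinv_0_lt_compat, lt_0_INR. lia. }
  apply (ex_series_le (K:=R_AbsRing) (V:=R_CompleteNormedModule) _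
    (fun n => 2 * / (INR (S n) * INR (S (S n))))).
  - intros n. change (Rabs (/ INR (S n) ^ s) <= 2 * / (INR (S n) * INR (S (S n)))).
    assert (H : 1 <= INR (S n)) by (apply (le_INR 1); lia).
    rewrite Rabs_right by (apply Rle_ge, Rlt_le, Rinv_0_lt_compat, pow_lt; lra).
    rewrite (S_INR (S n)).
    apply Rle_trans with (/ INR (S n) ^ 2).
    + apply Rinv_le_contravar; [apply pow_lt; lra|]. apply Rle_pow; [lra | lia].
    + rewrite <- (Rinv_inv 2), <- Rinv_mult. apply Rinv_le_contravar; nra.
  - exists (2 * 1). apply (is_series_scal_l 2 _ _ T).
Qed.

Lemma ex_series_inv_odd_pow (s : nat) :
  (2 <= s)%nat -> ex_series (fun n => / (2 * INR n + 1) ^ s).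
Proof.
  intros Hs.
  apply (ex_series_le (K:=R_AbsRing) (V:=R_CompleteNormedModule)) with (2 := ex_series_inv_pow s Hs).
  intros n. change (Rabs (/ (2 * INR n + 1) ^ s) <= / INR (S n) ^ s).
  rewrite S_INR. pose proof (pos_INR n).
  rewrite Rabs_right by (apply Rle_ge, Rlt_le, Rinv_0_lt_compat, pow_lt; lra).
  apply Rinv_le_contravar; [apply pow_lt; lra|]. apply pow_incr. lra.
Qed.

Lemma ex_series_alternating (a : nat -> R) :
  (forall n, 0 <= a n) -> ex_series a -> ex_series (fun n => (-1) ^ n * a n).
Proof.
  intros Ha H. apply ex_series_Rabs. revert H. apply ex_series_ext. intros n.
  rewrite Rabs_mult, pow_1_abs, Rabs_right; [symmetry; apply Rmult_1_l | apply Rle_ge, Ha].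
Qed.

(** The alternating sum is the full sum minus twice its even-base terms, and those are [/ 2 ^ s]
    times the full sum. Absolute convergence gives a limit in advance, so comparing one subsequence
    of partial sums identifies it. *)
Lemma is_series_eta (s : nat) :
  (2 <= s)%nat -> is_series (fun n => (-1) ^ n / INR (S n) ^ s) ((1 - 2 / 2 ^ s) * zeta s).
Proof.
  intros Hs.
  set (z := fun n => / INR (S n) ^ s). set (a := fun n => (-1) ^ n * z n).
  assert (Z : is_series z (zeta s)) by apply Series_correct, ex_series_inv_pow, Hs.
  assert (A : is_series a (Series a)).
  { apply Series_correct, ex_series_alternating; [|eexists; exact Z].
    intros n. apply Rlt_le, Rinv_0_lt_compat, pow_lt, lt_0_INR. lia. }
  replace ((1 - 2 / 2 ^ s) * zeta s) with (Series a); [exact A|].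
  (* Index [n] carries the base [n + 1]: the odd indices carry the even bases and the minus signs,
     and stopping at [2 * N + 1] takes in exactly [N + 1] of them. *)
  assert (E : forall N, sum_n a (2 * N + 1) = sum_n z (2 * N + 1) - 2 / 2 ^ s * sum_n z N).
  { assert (P : 2 ^ s <> 0) by (apply pow_nonzero; lra).
    assert (D : forall N, z (2 * N + 1)%nat = / 2 ^ s * z N).
    { intros N. unfold z. replace (S (2 * N + 1)) with (2 * S N)%nat by lia.
      rewrite mult_INR, Rpow_mult_distr, Rinv_mult. reflexivity. }
    assert (A0 : forall N, a (2 * N)%nat = z (2 * N)%nat).
    { intros N. unfold a. rewrite pow_1_even. ring. }
    assert (A1 : forall N, a (2 * N + 1)%nat = - z (2 * N + 1)%nat).
    { intros N. unfold a. replace (2 * N + 1)%nat with (S (2 * N)) by lia.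
      rewrite pow_1_odd. ring. }
    assert (Su : forall (u : nat -> R) N,
      sum_n u (2 * N + 1) = sum_n u (2 * N) + u (2 * N + 1)%nat).
    { intros u N. replace (2 * N + 1)%nat with (S (2 * N)) by lia.
      apply (sum_Sn (G:=R_AbelianMonoid)). }
    induction N as [|N IH].
    - rewrite !Su, A1, D. simpl. rewrite !sum_O.
      assert (H := A0 O). simpl in H. rewrite H. simpl. field. exact P.
    - rewrite !Su. replace (2 * S N)%nat with (S (2 * N + 1)) at 1 3 by lia.
      rewrite !sum_Sn, IH, A1, D. replace (S (2 * N + 1))%nat with (2 * S N)%nat by lia.
      rewrite A0. unfold plus; simpl. field. exact P. }
  assert (Sub : filterlim (fun N => 2 * N + 1)%nat eventually eventually).
  { apply eventually_subseq. intros n. lia. }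
  change (is_lim_seq (sum_n a) (Series a)) in A.
  change (is_lim_seq (sum_n z) (zeta s)) in Z.
  assert (L1 := is_lim_seq_subseq _ _ _ Sub A).
  assert (L2 := is_lim_seq_subseq _ _ _ Sub Z).
  assert (L3 := is_lim_seq_minus' _ _ _ _ L2 (is_lim_seq_scal_l _ (2 / 2 ^ s) _ Z)).
  assert (U : Finite (Series a) = Finite (zeta s - 2 / 2 ^ s * zeta s)).
  { rewrite <- (is_lim_seq_unique _ _ L1), <- (is_lim_seq_unique _ _ L3).
    apply Lim_seq_ext, E. }
  injection U as U. rewrite U. ring.
Qed.

(** * Partial fractions of the hyperbolic secant *)

(** A weak Jordan inequality. On [0, PI/4] the cosine is at least [c], so
    [sin (x / 2) >= c * (x / 2)]; doubling the angle gives [sin x >= 2 * c ^ 2 * (x / 2)], where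
    [c ^ 2 = / 2]. *)
Lemma half_le_sin (x : R) : 0 <= x <= PI / 2 -> x / 2 <= sin x.
Proof.
  intros Hx. pose proof PI_RGT_0.
  set (c := cos (PI / 4)).
  assert (Hc : 0 < c) by (apply cos_gt_0; lra).
  assert (Hc2 : c * c = / 2).
  { pose proof (cos_2a_cos (PI / 4)) as E. replace (2 * (PI / 4)) with (PI / 2) in E by field.
    rewrite cos_PI2 in E. fold c in E. lra. }
  assert (cos_ge : forall y, 0 <= y <= PI / 4 -> c <= cos y)
    by (intros y Hy; apply cos_decr_1; lra).
  assert (sin_ge : c * (x / 2) <= sin (x / 2)).
  { assert (B := increment_le (fun y => c * y) (fun _ => c) sin cos 0 (x / 2) ltac:(lra)).
    rewrite sin_0, Rmult_0_r, !Rminus_0_r in B.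
    eapply Rle_trans; [apply Rle_abs|]. apply B.
    - intros y _. auto_derive; [easy | ring].
    - intros y _. apply is_derive_Reals, derivable_pt_lim_sin.
    - intros y Hy. rewrite Rabs_right by lra. apply cos_ge. lra. }
  replace x with (2 * (x / 2)) at 2 by field. rewrite sin_2a.
  assert (C := cos_ge (x / 2) ltac:(lra)).
  assert (c * (x / 2) * c <= sin (x / 2) * cos (x / 2)).
  { apply Rmult_le_compat; try lra. apply Rmult_le_pos; lra. }
  nra.
Qed.

Lemma sin_cos_odd_PI2 (k : nat) :
  sin ((2 * INR k + 1) * (PI / 2)) = (-1) ^ k /\ cos ((2 * INR k + 1) * (PI / 2)) = 0.
Proof.
  induction k as [|k [IH1 IH2]].
  - simpl. replace ((2 * 0 + 1) * (PI / 2)) with (PI / 2) by ring.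
    split; [apply sin_PI2 | apply cos_PI2].
  - rewrite S_INR.
    replace ((2 * (INR k + 1) + 1) * (PI / 2)) with ((2 * INR k + 1) * (PI / 2) + PI) by field.
    rewrite neg_sin, neg_cos, IH1, IH2. simpl. split; ring.
Qed.

(** Telescoping: [2 * sin x * cos (m * x) = sin ((m + 1) * x) - sin ((m - 1) * x)] for odd [m]. *)
Lemma sum_cos_odd (N : nat) (x : R) :
  2 * sin x * sum_n (fun k => cos ((2 * INR k + 1) * x)) N = sin (2 * INR (S N) * x).
Proof.
  induction N as [|N IH].
  - rewrite sum_O. simpl. replace ((2 * 0 + 1) * x) with x by ring.
    replace (2 * 1 * x) with (2 * x) by ring. now rewrite sin_2a.
  - rewrite sum_Sn. unfold plus. simpl AbelianMonoid.sort.
    rewrite Rmult_plus_distr_l.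
    replace (2 * sin x * sum_n _ N) with (sin (2 * INR (S N) * x)) by (symmetry; exact IH).
    rewrite (S_INR (S N)).
    replace (2 * INR (S N) * x) with ((2 * INR (S N) + 1) * x - x) by ring.
    replace (2 * (INR (S N) + 1) * x) with ((2 * INR (S N) + 1) * x + x) by ring.
    rewrite sin_plus, sin_minus. ring.
Qed.

(** Partial sums of the Fourier series of the square wave that equals [PI / 4] on the open interval
    from 0 to [PI]. *)
Definition sine_sum (N : nat) (x : R) : R :=
  sum_n (fun k => sin ((2 * INR k + 1) * x) / (2 * INR k + 1)) N.

Lemma is_derive_sine_sum (N : nat) (x : R) :
  is_derive (sine_sum N) x (sum_n (fun k => cos ((2 * INR k + 1) * x)) N).
Proof.
  apply (is_derive_sum_n (fun k y => sin ((2 * INR k + 1) * y) / (2 * INR k + 1))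
    (fun k y => cos ((2 * INR k + 1) * y))).
  intros n. pose proof (pos_INR n). auto_derive; [easy | field; lra].
Qed.

(** After integration by parts the remaining integral is at most [/ (2 * M * sin x) - / (2 * M)],
    and the boundary terms at most [/ (2 * M * sin x)] and [/ (2 * M)]. The contributions of
    [PI / 2] cancel, leaving [/ (M * sin x)]. *)
Lemma sine_sum_tail_le (N : nat) (x : R) :
  0 < x <= PI / 2 ->
  Rabs (sine_sum N (PI / 2) - sine_sum N x) <= / (2 * INR (S N) * sin x).
Proof.
  intros Hx. pose proof PI_RGT_0.
  assert (Hs : forall u, x <= u <= PI / 2 -> 0 < sin u) by (intros; apply sin_gt_0; lra).
  assert (Hsx := Hs x ltac:(lra)).
  set (M := 2 * INR (S N)).
  assert (HM : 0 < M) by (unfold M; pose proof (lt_0_INR (S N) ltac:(lia)); lra).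
  (* [r] is the boundary term of an integration by parts of the derivative
     [sin (M u) / (2 sin u)] of [sine_sum N]. *)
  set (r := fun u => cos (M * u) / (2 * M * sin u)).
  assert (B : Rabs ((sine_sum N (PI / 2) + r (PI / 2)) - (sine_sum N x + r x))
     <= - / (2 * M * sin (PI / 2)) - - / (2 * M * sin x)).
  { apply (increment_le (fun u => sine_sum N u + r u)
      (fun u => - (cos (M * u) * cos u / (2 * M * (sin u) ^ 2)))
      (fun u => - / (2 * M * sin u))
      (fun u => cos u / (2 * M * (sin u) ^ 2)) x (PI / 2) ltac:(lra)).
    - intros u Hu. specialize (Hs u Hu).
      assert (H2M : 0 < 2 * M * sin u) by (apply Rmult_lt_0_compat; lra).
      replace (- _) with (sum_n (fun k => cos ((2 * INR k + 1) * u)) N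
        + (- (M * sin (M * u)) / (2 * M * sin u)
           - cos (M * u) * cos u / (2 * M * (sin u) ^ 2))).
      + apply (is_derive_plus (V:=R_NormedModule)); [apply is_derive_sine_sum|].
        unfold r. auto_derive; [lra|]. field. lra.
      + assert (D := sum_cos_odd N u). fold M in D. rewrite <- D. field. lra.
    - intros u Hu. specialize (Hs u Hu).
      assert (H2M : 0 < 2 * M * sin u) by (apply Rmult_lt_0_compat; lra).
      auto_derive; [lra|]. field. lra.
    - intros u Hu. specialize (Hs u Hu).
      assert (0 <= cos u) by (apply cos_ge_0; lra).
      assert (P : 0 < 2 * M * sin u ^ 2) by (apply Rmult_lt_0_compat; [lra | now apply pow_lt]).
      rewrite Rabs_Ropp. unfold Rdiv. rewrite !Rabs_mult.
      rewrite (Rabs_right (cos u)) by lra.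
      rewrite (Rabs_right (/ _)) by (apply Rle_ge, Rlt_le, Rinv_0_lt_compat, P).
      apply Rmult_le_compat_r; [apply Rlt_le, Rinv_0_lt_compat, P|].
      assert (Rabs (cos (M * u)) <= 1) by (apply Rabs_le, COS_bound). nra. }
  assert (R_ : forall u, 0 < sin u -> Rabs (r u) <= / (2 * M * sin u)).
  { intros u Hu. unfold r, Rdiv. rewrite Rabs_mult.
    assert (P : 0 < / (2 * M * sin u))
      by (apply Rinv_0_lt_compat, Rmult_lt_0_compat; lra).
    rewrite (Rabs_right (/ _)) by lra.
    assert (Rabs (cos (M * u)) <= 1) by (apply Rabs_le, COS_bound). nra. }
  assert (R1 := R_ x Hsx). assert (R2 := R_ (PI / 2) (Hs (PI / 2) ltac:(lra))).
  replace (/ (M * sin x)) with (2 * / (2 * M * sin x)) by (field; lra).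
  apply Rabs_le_between in B. apply Rabs_le_between in R1. apply Rabs_le_between in R2.
  apply Rabs_le. lra.
Qed.

Lemma cosh_pos (x : R) : 0 < cosh x.
Proof. unfold cosh. pose proof (exp_pos x). pose proof (exp_pos (- x)). lra. Qed.

Lemma cosh_le_exp_abs (x y : R) : Rabs x <= y -> cosh x <= exp y.
Proof.
  intros H. apply Rabs_le_between in H. unfold cosh.
  assert (M : forall u, u <= y -> exp u <= exp y).
  { intros u [Hu | ->]; [now apply Rlt_le, exp_increasing | lra]. }
  assert (H1 := M x ltac:(lra)). assert (H2 := M (- x) ltac:(lra)). lra.
Qed.

(** The kernel [sum_n (fun k => cos ((2 * INR k + 1) * x)) N] is integrated over [0, PI/2] against
    [cosh (t * x)] and against 1. The first integral is [cosh (PI * t / 2)] times a partial sum of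
    the series, the second a partial sum of Leibniz's series. Their difference tends to 0, as the
    kernel concentrates at 0, where [cosh (t * x)] is 1. *)
Lemma is_series_sech (t : R) :
  is_series (fun k => (-1) ^ k * ((2 * INR k + 1) / (t ^ 2 + (2 * INR k + 1) ^ 2)))
    (PI / 4 / cosh (PI * t / 2)).
Proof.
  pose proof PI_RGT_0 as HPI.
  assert (HPI4 : PI <= 4) by (pose proof PI_4; lra).
  assert (Hm : forall k, 1 <= 2 * INR k + 1) by (intros k; pose proof (pos_INR k); lra).
  assert (Hden : forall k, 0 < t ^ 2 + (2 * INR k + 1) ^ 2)
    by (intros k; pose proof (pow2_ge_0 t); pose proof (Hm k); nra).
  (* A Lipschitz constant for [t * sinh (t * x)] on [0, PI/2]: its derivative is
     [t ^ 2 * cosh (t * x)], and [PI <= 4] gives [Rabs (t * x) <= 2 * Rabs t]. *)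
  set (K0 := t ^ 2 * exp (2 * Rabs t)).
  assert (HK0 : 0 <= K0).
  { apply Rmult_le_pos; [apply pow2_ge_0 | apply Rlt_le, exp_pos]. }
  assert (Hsinh : forall x, 0 <= x <= PI / 2 -> Rabs (t * sinh (t * x)) <= K0 * x).
  { intros x Hx.
    assert (B := increment_le (fun u => t * sinh (t * u)) (fun u => t ^ 2 * cosh (t * u))
      (fun u => K0 * u) (fun _ => K0) 0 x ltac:(lra)).
    rewrite !Rmult_0_r, sinh_0, Rmult_0_r, !Rminus_0_r in B. apply B.
    - intros u _. auto_derive; [easy | ring].
    - intros u _. auto_derive; [easy | ring].
    - intros u Hu. rewrite Rabs_right.
      2:{ apply Rle_ge, Rmult_le_pos; [apply pow2_ge_0 | apply Rlt_le, cosh_pos]. }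
      apply Rmult_le_compat_l; [apply pow2_ge_0|]. apply cosh_le_exp_abs.
      rewrite Rabs_mult, Rmult_comm, (Rabs_right u) by lra.
      apply Rmult_le_compat_r; [apply Rabs_pos | lra]. }
  (* The primitive, vanishing at 0, of [cosh (t * x)] times the cosine kernel, found by integrating
     each term by parts twice. *)
  set (A := fun N x => sum_n (fun k =>
    (t * sinh (t * x) * cos ((2 * INR k + 1) * x)
     + (2 * INR k + 1) * cosh (t * x) * sin ((2 * INR k + 1) * x))
    / (t ^ 2 + (2 * INR k + 1) ^ 2)) N).
  assert (DA : forall N x, is_derive (A N) x
    (cosh (t * x) * sum_n (fun k => cos ((2 * INR k + 1) * x)) N)).
  { intros N x. rewrite <- (sum_n_mult_l (K:=R_Ring)).
    apply (is_derive_sum_n (fun k y => (t * sinh (t * y) * cos ((2 * INR k + 1) * y)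
     + (2 * INR k + 1) * cosh (t * y) * sin ((2 * INR k + 1) * y))
    / (t ^ 2 + (2 * INR k + 1) ^ 2)) (fun k y => cosh (t * y) * cos ((2 * INR k + 1) * y))).
    intros k. specialize (Hden k). auto_derive; [easy|]. field. simpl in *; lra. }
  assert (A0 : forall N, A N 0 = 0).
  { intros N. unfold A.
    transitivity (sum_n (fun _ => 0) N); [|rewrite sum_n_const; apply Rmult_0_r].
    apply sum_n_ext. intros k. rewrite !Rmult_0_r, sin_0, sinh_0.
    as_real_eq. field. specialize (Hden k). simpl in *; lra. }
  set (T := cosh (PI * t / 2)). assert (HT : 0 < T) by apply cosh_pos.
  assert (API : forall N, A N (PI / 2) - sine_sum N (PI / 2)
    = sum_n (fun k => (-1) ^ k * (T * (2 * INR k + 1) / (t ^ 2 + (2 * INR k + 1) ^ 2)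
        - / (2 * INR k + 1))) N).
  { intros N. unfold A, sine_sum.
    transitivity (minus (sum_n (fun k =>
    (t * sinh (t * (PI / 2)) * cos ((2 * INR k + 1) * (PI / 2))
     + (2 * INR k + 1) * cosh (t * (PI / 2)) * sin ((2 * INR k + 1) * (PI / 2)))
    / (t ^ 2 + (2 * INR k + 1) ^ 2)) N)
     (sum_n (fun k => sin ((2 * INR k + 1) * (PI / 2)) / (2 * INR k + 1)) N)).
    { unfold minus, plus, opp; simpl. ring. }
    induction N as [|N IH].
    - rewrite !sum_O. destruct (sin_cos_odd_PI2 0) as [-> ->].
      replace (t * (PI / 2)) with (PI * t / 2) by field. fold T.
      unfold minus, plus, opp; cbn -[INR pow]. specialize (Hm O). specialize (Hden O).
      field. lra.
    - rewrite !sum_Sn, <- IH. destruct (sin_cos_odd_PI2 (S N)) as [-> ->].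
      replace (t * (PI / 2)) with (PI * t / 2) by field. fold T.
      unfold minus, plus, opp; cbn -[INR pow sum_n]. specialize (Hm (S N)). specialize (Hden (S N)).
      field. lra. }
  assert (S0 : is_series (fun k => (-1) ^ k * (T * (2 * INR k + 1)
      / (t ^ 2 + (2 * INR k + 1) ^ 2) - / (2 * INR k + 1))) 0).
  { (* The function below takes the values [sine_sum N (PI/2)] at [0] and [A N (PI/2)] at
       [PI/2], and its derivative is [O(1/N)]: the pole of the tail bound at [0] is
       cancelled by [sinh (t x)]. *)
    apply (is_lim_seq_of_bound _ _ (2 * K0)). intros N.
    enough (B : Rabs (A N (PI / 2) - sine_sum N (PI / 2) - 0) <= 2 * K0 / INR (S N))
      by (rewrite (API N) in B; exact B).
    assert (HN : 0 < INR (S N)) by (apply lt_0_INR; lia).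
    assert (B := increment_le
      (fun x => A N x - cosh (t * x) * (sine_sum N x - sine_sum N (PI / 2)))
      (fun x => t * sinh (t * x) * (sine_sum N (PI / 2) - sine_sum N x))
      (fun x => K0 / INR (S N) * x) (fun _ => K0 / INR (S N)) 0 (PI / 2) ltac:(lra)).
    assert (D0 : sine_sum N 0 = 0).
    { unfold sine_sum. transitivity (sum_n (fun _ => 0) N); [|rewrite sum_n_const; apply Rmult_0_r].
      apply sum_n_ext. intros k. rewrite !Rmult_0_r, sin_0.
      as_real_eq. field. specialize (Hm k). lra. }
    cbv beta in B. rewrite A0, D0, !Rmult_0_r, cosh_0 in B.
    replace (A N (PI / 2) - sine_sum N (PI / 2) - 0)
      with (A N (PI / 2) - cosh (t * (PI / 2)) * (sine_sum N (PI / 2) - sine_sum N (PI / 2))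
        - (0 - 1 * (0 - sine_sum N (PI / 2)))) by ring.
    eapply Rle_trans; [apply B|].
    - intros x _.
      replace (t * sinh (t * x) * (sine_sum N (PI / 2) - sine_sum N x))
        with (cosh (t * x) * sum_n (fun k => cos ((2 * INR k + 1) * x)) N
          - (t * sinh (t * x) * (sine_sum N x - sine_sum N (PI / 2))
             + cosh (t * x) * (sum_n (fun k => cos ((2 * INR k + 1) * x)) N - 0))) by ring.
      apply (is_derive_minus (V:=R_NormedModule)); [apply DA|].
      apply (is_derive_mult (K:=R_AbsRing) (fun x => cosh (t * x))
        (fun x => sine_sum N x - sine_sum N (PI / 2))); [| |intros; apply Rmult_comm].
      + auto_derive; [easy | ring].
      + apply (is_derive_minus (V:=R_NormedModule)); [apply is_derive_sine_sum|].
        apply (is_derive_const (V:=R_NormedModule)).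
    - intros x _. generalize (K0 / INR (S N)). intros c. auto_derive; [easy | ring].
    - intros x Hx. destruct (Rle_lt_or_eq_dec 0 x) as [Hx0 | <-]; [lra| |].
      2:{ rewrite Rmult_0_r, sinh_0, Rmult_0_r, Rmult_0_l, Rabs_R0.
          apply Rmult_le_pos; [exact HK0 | apply Rlt_le, Rinv_0_lt_compat, HN]. }
      rewrite Rabs_mult.
      (* Since [2 * sin x >= x], the tail bound is at most [/ (INR (S N) * x)]; its pole meets the
         factor [x] of the Lipschitz bound. *)
      apply Rle_trans with (K0 * x * / (INR (S N) * x)).
      + apply Rmult_le_compat; try apply Rabs_pos; [apply Hsinh; lra|].
        eapply Rle_trans; [apply sine_sum_tail_le; lra|].
        apply Rinv_le_contravar; [now apply Rmult_lt_0_compat|].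
        pose proof (half_le_sin x Hx). nra.
      + right. field. lra.
    - assert (0 <= K0 / INR (S N)) by (apply Rdiv_le_0_compat; lra).
      replace (2 * K0 / INR (S N)) with (K0 / INR (S N) * 2) by (field; lra). nra. }
  (* Adding Leibniz's series removes the terms [/ (2 * INR k + 1)]; dividing by [T] then leaves the
     claim. *)
  assert (H := is_series_plus _ _ _ _ S0 is_series_leibniz).
  assert (H' := is_series_scal_l (/ T) _ _ H).
  replace (PI / 4 / T) with (/ T * plus 0 (PI / 4)) by (unfold plus; simpl; field; lra).
  revert H'. apply is_series_ext. intros k. unfold plus; cbn -[pow INR].
  specialize (Hm k). specialize (Hden k). field. lra.
Qed.

(** * Beta values as Taylor coefficients of the hyperbolic secant *)

Definition dirichlet_beta (s : nat) : R :=
  Series (fun k => (-1) ^ k / (2 * INR k + 1) ^ s).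

(** For [p = 0] the convergence is only conditional and comes from Leibniz's series; for larger [p]
    it is absolute. *)
Lemma is_series_dirichlet_beta (p : nat) :
  is_series (fun k => (-1) ^ k / (2 * INR k + 1) ^ (2 * p + 1))
    (dirichlet_beta (2 * p + 1)).
Proof.
  apply Series_correct. destruct p as [|p].
  - exists (PI / 4). generalize is_series_leibniz. apply is_series_ext.
    intros k. now rewrite pow_1.
  - apply ex_series_alternating; [|apply ex_series_inv_odd_pow; lia].
    intros k. pose proof (pos_INR k). apply Rlt_le, Rinv_0_lt_compat, pow_lt. lra.
Qed.

(** With [m = 2 * k + 1], each [m / (t ^ 2 + m ^ 2)] is expanded geometrically in [- t ^ 2 / m ^ 2].
    Only finitely many orders are split off at a time, with an exact remainder series, so no double
    series, here not absolutely convergent, is ever rearranged. *)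
Lemma is_pseries_sech (t : R) :
  Rabs t < 1 ->
  is_pseries (fun p => (-1) ^ p * dirichlet_beta (2 * p + 1)) (t ^ 2)
    (PI / 4 / cosh (PI * t / 2)).
Proof.
  intros Ht. apply is_pseries_R.
  assert (Hm : forall k, 1 <= 2 * INR k + 1) by (intros k; pose proof (pos_INR k); lra).
  assert (Hden : forall k, 0 < t ^ 2 + (2 * INR k + 1) ^ 2)
    by (intros k; pose proof (pow2_ge_0 t); pose proof (Hm k); nra).
  set (L := PI / 4 / cosh (PI * t / 2)).
  set (c := fun p => (-1) ^ p * dirichlet_beta (2 * p + 1) * (t ^ 2) ^ p).
  assert (R_ : forall P, is_series (fun k => (-1) ^ k * ((2 * INR k + 1)
      / (t ^ 2 + (2 * INR k + 1) ^ 2) * (- t ^ 2 / (2 * INR k + 1) ^ 2) ^ S P))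
      (L - sum_n c P)).
  { assert (Step : forall P l, is_series (fun k => (-1) ^ k * ((2 * INR k + 1)
      / (t ^ 2 + (2 * INR k + 1) ^ 2) * (- t ^ 2 / (2 * INR k + 1) ^ 2) ^ P)) l ->
      is_series (fun k => (-1) ^ k * ((2 * INR k + 1)
      / (t ^ 2 + (2 * INR k + 1) ^ 2) * (- t ^ 2 / (2 * INR k + 1) ^ 2) ^ S P)) (l - c P)).
    { intros P l H.
      assert (H2 := is_series_scal_l ((-1) ^ P * (t ^ 2) ^ P) _ _ (is_series_dirichlet_beta P)).
      assert (H3 := is_series_minus _ _ _ _ H H2).
      replace (l - c P) with (minus l ((-1) ^ P * (t ^ 2) ^ P * dirichlet_beta (2 * P + 1)))
        by (unfold c, minus, plus, opp; simpl; ring).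
      revert H3. apply is_series_ext. intros k.
      specialize (Hm k). specialize (Hden k).
      rewrite <- (tech_pow_Rmult _ P).
      replace ((- t ^ 2 / (2 * INR k + 1) ^ 2) ^ P)
        with ((-1) ^ P * (t ^ 2) ^ P / ((2 * INR k + 1) ^ 2) ^ P).
      2:{ unfold Rdiv. rewrite <- pow_inv, <- !Rpow_mult_distr. f_equal. field. lra. }
      rewrite pow_add, (pow_mult _ 2 P), pow_1.
      assert (HP : ((2 * INR k + 1) ^ 2) ^ P <> 0) by (apply pow_nonzero, pow_nonzero; lra).
      revert HP. generalize (((2 * INR k + 1) ^ 2) ^ P) ((t ^ 2) ^ P) ((-1) ^ P) ((-1) ^ k).
      intros. unfold minus, plus, opp; cbn -[pow INR]. field. repeat split; lra. }
    induction P as [|P IH].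
    - rewrite sum_O. apply Step. generalize (is_series_sech t). apply is_series_ext.
      intros k. simpl (_ ^ 0). now rewrite Rmult_1_r.
    - rewrite sum_Sn. replace (L - plus (sum_n c P) (c (S P))) with (L - sum_n c P - c (S P))
        by (unfold plus; simpl; ring).
      now apply Step. }
  set (C := Series (fun k => / (2 * INR k + 1) ^ 2)).
  assert (HC : is_series (fun k => / (2 * INR k + 1) ^ 2) C)
    by now apply Series_correct, ex_series_inv_odd_pow.
  (* The exponent [S P] is at least 1, so every remainder term has a factor [/ m ^ 2], which makes
     the remainder absolutely summable uniformly in [P]. *)
  assert (B : forall P, Rabs (L - sum_n c P) <= (t ^ 2) ^ S P * C).
  { intros P.
    assert (H2 := is_series_scal_l ((t ^ 2) ^ S P) _ _ HC).
    rewrite <- (is_series_unique _ _ (R_ P)).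
    replace ((t ^ 2) ^ S P * C)
      with (Series (fun k => (t ^ 2) ^ S P * / (2 * INR k + 1) ^ 2))
      by exact (is_series_unique _ _ H2).
    assert (Le : forall k, Rabs ((-1) ^ k * ((2 * INR k + 1) / (t ^ 2 + (2 * INR k + 1) ^ 2) *
      (- t ^ 2 / (2 * INR k + 1) ^ 2) ^ S P)) <= (t ^ 2) ^ S P * / (2 * INR k + 1) ^ 2).
    { intros k. specialize (Hm k). specialize (Hden k). set (m := 2 * INR k + 1) in *.
      pose proof (pow2_ge_0 t).
      rewrite Rabs_mult, pow_1_abs, Rmult_1_l, Rabs_mult, <- RPow_abs.
      unfold Rdiv. rewrite (Rabs_mult (- t ^ 2)), Rabs_Ropp, (Rabs_right (t ^ 2)) by lra.
      rewrite !Rabs_right; try (apply Rle_ge, Rlt_le, Rinv_0_lt_compat, pow_lt; lra).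
      2:{ apply Rle_ge, Rmult_le_pos; [lra | apply Rlt_le, Rinv_0_lt_compat; lra]. }
      rewrite Rpow_mult_distr.
      assert (I0 : 0 < / m ^ 2 <= 1).
      { split; [apply Rinv_0_lt_compat, pow_lt; lra|]. rewrite <- Rinv_1.
        apply Rinv_le_contravar; nra. }
      assert (I1 : 0 <= (/ m ^ 2) ^ S P <= / m ^ 2).
      { split; [apply pow_le; lra|]. rewrite <- tech_pow_Rmult.
        apply Rle_trans with (/ m ^ 2 * 1); [|lra]. apply Rmult_le_compat_l; [lra|].
        rewrite <- (pow1 P). apply pow_incr. lra. }
      assert (I2 : 0 <= m * / (t ^ 2 + m ^ 2) <= 1).
      { split.
        - apply Rmult_le_pos; [lra | apply Rlt_le, Rinv_0_lt_compat; lra].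
        - apply Rmult_le_reg_r with (t ^ 2 + m ^ 2); [lra|].
          rewrite Rmult_assoc, Rinv_l by lra. nra. }
      assert (0 <= (t ^ 2) ^ S P) by (apply pow_le; lra).
      rewrite <- (Rmult_1_l ((t ^ 2) ^ S P * / m ^ 2)).
      apply Rmult_le_compat; try lra; [apply Rmult_le_pos; lra|].
      apply Rmult_le_compat_l; lra. }
    eapply Rle_trans; [apply Series_Rabs|apply Series_le].
    - apply (ex_series_le (K:=R_AbsRing) (V:=R_CompleteNormedModule)) with (2 := ex_intro _ _ H2).
      intros k. change norm with Rabs. rewrite Rabs_Rabsolu. apply Le.
    - intros k. split; [apply Rabs_pos | apply Le].
    - eexists; exact H2. }
  assert (G : is_lim_seq (fun P => (t ^ 2) ^ S P * C) 0).
  { replace (Finite 0) with (Rbar_mult 0 C) by (simpl; f_equal; ring).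
    apply is_lim_seq_scal_r. apply (is_lim_seq_incr_1 (fun P => (t ^ 2) ^ P)).
    apply is_lim_seq_geom. apply Rabs_lt_between in Ht.
    rewrite Rabs_right by (apply Rle_ge, pow2_ge_0). nra. }
  assert (Z : is_lim_seq (fun P => L - sum_n c P) 0).
  { apply is_lim_seq_abs_0.
    apply (is_lim_seq_le_le (fun _ => 0) _ (fun P => (t ^ 2) ^ S P * C));
      [|apply is_lim_seq_const | exact G].
    intros P; split; [apply Rabs_pos | apply B]. }
  assert (W := is_lim_seq_minus' _ _ _ _ (is_lim_seq_const L) Z).
  rewrite Rminus_0_r in W. revert W. apply is_lim_seq_ext. intros P.
  change (L - (L - sum_n c P) = sum_n c P). ring.
Qed.

(** * Smoothness of the Bernoulli generating function *)

(** Differentiability up to order [n] on the whole line. Recursing on [Derive f] lets closure under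
    sums, products and inverses follow by induction from the first-order rules. *)
Fixpoint diff_n (n : nat) (f : R -> R) : Prop :=
  match n with
  | O => True
  | S m => (forall x, ex_derive f x) /\ diff_n m (Derive f)
  end.

Lemma diff_n_ex_derive_n (n : nat) (f : R -> R) :
  diff_n n f -> forall k x, (k <= n)%nat -> ex_derive_n f k x.
Proof.
  revert f. induction n as [|n IH]; intros f Hf k x Hk.
  - replace k with O by lia. exact I.
  - destruct k as [|[|k]]; [exact I | apply Hf |].
    assert (H := IH _ (proj2 Hf) (S k) x ltac:(lia)). simpl in H.
    revert H. apply ex_derive_ext. intros t.
    rewrite (Derive_n_comp f k 1). now rewrite Nat.add_1_r.
Qed.

Lemma diff_n_pred (n : nat) (f : R -> R) : diff_n (S n) f -> diff_n n f.
Proof.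
  revert f. induction n as [|n IH]; intros f Hf; [exact I|].
  split; [apply Hf | apply IH, Hf].
Qed.

Lemma diff_n_const (n : nat) (c : R) : diff_n n (fun _ => c).
Proof.
  revert c. induction n as [|n IH]; intros c; [exact I|].
  split; [intros; apply ex_derive_const|].
  replace (Derive (fun _ => c)) with (fun _ : R => 0); [apply IH|].
  apply functional_extensionality. intros x. now rewrite Derive_const.
Qed.

Lemma diff_n_plus (n : nat) (f g : R -> R) :
  diff_n n f -> diff_n n g -> diff_n n (fun x => f x + g x).
Proof.
  revert f g. induction n as [|n IH]; intros f g Hf Hg; [exact I|].
  destruct Hf as [Hf Hf'], Hg as [Hg Hg'].
  split; [intros x; now apply (ex_derive_plus (V:=R_NormedModule))|].
  replace (Derive _) with (fun x => Derive f x + Derive g x); [now apply IH|].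
  apply functional_extensionality. intros x. now rewrite Derive_plus.
Qed.

Lemma diff_n_mult (n : nat) (f g : R -> R) :
  diff_n n f -> diff_n n g -> diff_n n (fun x => f x * g x).
Proof.
  revert f g. induction n as [|n IH]; intros f g Hf Hg; [exact I|].
  split; [intros x; now apply ex_derive_mult; [apply Hf | apply Hg]|].
  replace (Derive _) with (fun x => Derive f x * g x + f x * Derive g x).
  - apply diff_n_plus; apply IH; try apply Hf; try apply Hg;
      now apply diff_n_pred.
  - apply functional_extensionality. intros x.
    rewrite Derive_mult; [easy | apply Hf | apply Hg].
Qed.

Lemma diff_n_inv (n : nat) (f : R -> R) :
  (forall x, f x <> 0) -> diff_n n f -> diff_n n (fun x => / f x).
Proof.
  intros Hf0. induction n as [|n IH]; intros Hf; [exact I|].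
  split; [intros x; apply ex_derive_inv; [apply Hf | apply Hf0]|].
  assert (H := IH (diff_n_pred _ _ Hf)).
  replace (Derive _) with (fun x => -1 * Derive f x * (/ f x * / f x)).
  - repeat apply diff_n_mult; try exact H; [apply diff_n_const | apply Hf].
  - apply functional_extensionality. intros x.
    rewrite Derive_inv; [| apply Hf | apply Hf0]. field. apply Hf0.
Qed.

Lemma diff_n_exp_scal (n : nat) (y : R) : diff_n n (fun x => exp (y * x)).
Proof.
  induction n as [|n IH]; [exact I|].
  assert (D : forall x, is_derive (fun x => exp (y * x)) x (y * exp (y * x)))
    by (intros x; auto_derive; [easy | ring]).
  split; [intros x; eexists; apply D|].
  replace (Derive _) with (fun x => y * exp (y * x)).
  - apply diff_n_mult; [apply diff_n_const | exact IH].
  - apply functional_extensionality. intros x. symmetry. apply is_derive_unique, D.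
Qed.

(** If the radius were at most [r], then [s] would lie outside the disk of convergence and the terms
    at [s] could not tend to 0. *)
Lemma CV_radius_gt (a : nat -> R) (r s : R) :
  0 <= r < s -> ex_pseries a s -> Rbar_lt r (CV_radius a).
Proof.
  intros Hrs H. destruct (Rbar_lt_le_dec r (CV_radius a)) as [L | L]; [exact L|].
  exfalso. apply (CV_disk_outside a s).
  - apply Rbar_le_lt_trans with r; [exact L|]. simpl. rewrite Rabs_right; lra.
  - apply ex_series_lim_0. apply ex_pseries_R, H.
Qed.

Lemma diff_n_PSeries (n : nat) (a : nat -> R) :
  (forall x : R, Rbar_lt (Rabs x) (CV_radius a)) -> diff_n n (PSeries a).
Proof.
  revert a. induction n as [|n IH]; intros a Ha; [exact I|].
  split; [intros x; now apply ex_derive_PSeries|].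
  replace (Derive (PSeries a)) with (PSeries (PS_derive a)).
  - apply IH. intros x. now rewrite CV_radius_derive.
  - apply functional_extensionality. intros x. symmetry. now apply Derive_PSeries.
Qed.

(** The function [(exp t - 1) / t] extends to an everywhere convergent power series [E] without real
    zeros. Thus the generating function is [exp (y * t) / E t] at every [t], which absorbs the case
    distinction at 0. *)
Lemma bernoulli_gf_diff_n (n : nat) (y : R) : diff_n n (bernoulli_gf y).
Proof.
  set (e := fun k => / INR (Factorial.fact k)).
  set (E := PSeries (PS_decr_1 e)).
  assert (HE : forall t, t * E t = exp t - 1).
  { intros t. unfold E. rewrite exp_Reals. fold e.
    rewrite (PSeries_decr_1 e t) by (eexists; apply is_exp_Reals).
    replace (e O) with 1 by (unfold e; simpl; field). fold E. ring. }
  assert (E0 : E 0 = 1).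
  { unfold E. rewrite PSeries_0. unfold PS_decr_1, e. simpl. field. }
  assert (HE0 : forall t, E t <> 0).
  { intros t Ht. destruct (Req_dec t 0) as [-> | Ht0]; [lra|].
    specialize (HE t). rewrite Ht, Rmult_0_r in HE.
    apply Ht0, exp_inv. rewrite exp_0. lra. }
  replace (bernoulli_gf y) with (fun t => exp (y * t) * / E t).
  - apply diff_n_mult; [apply diff_n_exp_scal|]. apply diff_n_inv; [exact HE0|].
    apply diff_n_PSeries. intros x. rewrite CV_radius_decr_1.
    apply (CV_radius_gt _ _ (Rabs x + 1)).
    + pose proof (Rabs_pos x). lra.
    + eexists. apply is_exp_Reals.
  - apply functional_extensionality. intros t. unfold bernoulli_gf.
    destruct (Req_EM_T t 0) as [-> | Ht].
    + rewrite E0, Rmult_0_r, exp_0. field.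
    + rewrite <- HE. field. split; [apply HE0 | exact Ht].
Qed.

(** * Odd Bernoulli polynomials at 1/4 *)

(** With [w = exp (t / 4)] the difference is [t * (w - w ^ 3) / (w ^ 4 - 1) = - t / (w + / w)]. *)
Lemma bernoulli_gf_quarter_odd (t : R) :
  bernoulli_gf (1 / 4) t - bernoulli_gf (1 / 4) (- t) = - (t / 2) / cosh (t / 4).
Proof.
  pose proof (cosh_pos (t / 4)) as Hc.
  unfold bernoulli_gf.
  destruct (Req_EM_T t 0) as [-> | Ht]; destruct (Req_EM_T (- _) 0) as [Hn | Hn]; try lra.
  unfold cosh in *.
  replace (exp (1 / 4 * - t)) with (/ exp (t / 4)) by (rewrite <- exp_Ropp; f_equal; field).
  replace (exp (- (t / 4))) with (/ exp (t / 4)) in * by (rewrite <- exp_Ropp; f_equal; field).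
  replace (exp (1 / 4 * t)) with (exp (t / 4)) by (f_equal; field).
  assert (E : exp t = exp (t / 4) ^ 4).
  { replace (exp t) with (exp (t / 4 + t / 4 + (t / 4 + t / 4))) by (f_equal; field).
    rewrite !exp_plus. ring. }
  rewrite (exp_Ropp t), E.
  assert (N1 : exp (t / 4) ^ 4 <> 1).
  { rewrite <- E, <- exp_0. intros H. apply exp_inv in H. lra. }
  pose proof (exp_pos (t / 4)) as Hp. revert N1 Hp. generalize (exp (t / 4)). intros w N1 Hp.
  field. repeat split; try nra.
Qed.

(** The derivative of order [2 * p + 1] at 0 of the odd difference [o] is computed twice: from its
    power series, with beta values as coefficients, and from the generating function. *)
Lemma bernoulli_poly_odd_quarter (p : nat) :
  bernoulli_poly (2 * p + 1) (1 / 4)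
  = (-1) ^ (p + 1) * 2 * INR (Factorial.fact (2 * p + 1)) / (2 * PI) ^ (2 * p + 1)
    * dirichlet_beta (2 * p + 1).
Proof.
  pose proof PI_RGT_0 as HPI.
  assert (H2PI : 2 * PI > 1) by (pose proof PI2_1; lra).
  set (o := fun t => bernoulli_gf (1 / 4) t - bernoulli_gf (1 / 4) (- t)).
  (* The coefficient of [t ^ (2 * q + 1)] in [- (t / 2) / cosh (t / 4)]: the secant series is taken
     at [t / (2 * PI)] and multiplied by [- (2 / PI) * t], where [2 / PI = 4 / (2 * PI)]. *)
  set (b := fun q => - 4 / (2 * PI) ^ (2 * q + 1) * ((-1) ^ q * dirichlet_beta (2 * q + 1))).
  set (a := fun n => if Nat.even n then 0 else b (Nat.div2 n)).
  assert (a0 : forall q, a (2 * q)%nat = 0).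
  { intros q. unfold a. now rewrite Nat.even_even. }
  assert (a1 : forall q, a (2 * q + 1)%nat = b q).
  { intros q. unfold a. rewrite Nat.even_odd. f_equal.
    rewrite Nat.add_1_r. apply Nat.div2_succ_double. }
  assert (Ho : forall t, Rabs t < 1 -> is_pseries a t (o t)).
  { intros t Ht.
    replace (o t) with (0 + t * (- (2 / PI) * (PI / 4 / cosh (PI * (t / (2 * PI)) / 2)))).
    2:{ unfold o. rewrite bernoulli_gf_quarter_odd.
        replace (PI * (t / (2 * PI)) / 2) with (t / 4) by (field; lra).
        field. pose proof (cosh_pos (t / 4)). lra. }
    apply is_pseries_odd_even.
    - apply is_pseries_R.
      change (is_lim_seq (sum_n (fun q => a (2 * q)%nat * (t ^ 2) ^ q)) 0).
      apply (is_lim_seq_ext (fun _ => 0)); [|apply is_lim_seq_const].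
      intros N. transitivity (sum_n (fun _ => 0) N).
      + rewrite sum_n_const. symmetry. apply Rmult_0_r.
      + apply sum_n_ext. intros q. rewrite a0. symmetry. apply Rmult_0_l.
    - assert (Hs : Rabs (t / (2 * PI)) < 1).
      { unfold Rdiv. rewrite Rabs_mult, (Rabs_right (/ _)).
        2:{ apply Rle_ge, Rlt_le, Rinv_0_lt_compat. lra. }
        apply Rmult_lt_reg_r with (2 * PI); [lra|]. rewrite Rmult_assoc, Rinv_l by lra. lra. }
      apply is_pseries_R.
      assert (H := is_series_scal_l (- (2 / PI)) _ _
        (proj1 (is_pseries_R _ _ _) (is_pseries_sech _ Hs))).
      revert H. apply is_series_ext. intros q. rewrite a1. unfold b.
      rewrite pow_add, (pow_mult (2 * PI)), pow_1.
      replace ((t / (2 * PI)) ^ 2) with (t ^ 2 * / (2 * PI) ^ 2) by (field; lra).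
      rewrite Rpow_mult_distr, pow_inv.
      assert (HP : ((2 * PI) ^ 2) ^ q <> 0) by (apply pow_nonzero, pow_nonzero; lra).
      revert HP. generalize (((2 * PI) ^ 2) ^ q). intros y Hy.
      as_real_eq. change (scal ?u ?v) with (u * v). field. lra. }
  assert (CV : Rbar_lt 0 (CV_radius a)).
  { apply (CV_radius_gt _ _ (1 / 2)); [lra|]. eexists. apply Ho. rewrite Rabs_right; lra. }
  assert (D : Derive_n o (2 * p + 1) 0 = b p * INR (Factorial.fact (2 * p + 1))).
  { rewrite <- a1, <- (Derive_n_coef a _ CV). apply Derive_n_ext_loc.
    exists (mkposreal 1 Rlt_0_1). intros t Ht. symmetry. apply is_pseries_unique, Ho.
    change (Rabs (t - 0) < 1) in Ht. now rewrite Rminus_0_r in Ht. }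
  assert (Sm : forall k x, ex_derive_n (bernoulli_gf (1 / 4)) k x).
  { intros k x. apply (diff_n_ex_derive_n k); [apply bernoulli_gf_diff_n | lia]. }
  (* At odd order the reflection of the argument changes the sign, so the difference doubles the
     derivative. *)
  assert (D2 : Derive_n o (2 * p + 1) 0 = 2 * bernoulli_poly (2 * p + 1) (1 / 4)).
  { unfold o. rewrite Derive_n_minus.
    - rewrite Derive_n_comp_opp by (apply filter_forall; intros; apply Sm).
      unfold bernoulli_poly. rewrite Ropp_0, Nat.add_1_r, pow_1_odd. ring.
    - apply filter_forall; intros; apply Sm.
    - apply filter_forall; intros. apply ex_derive_n_comp_opp.
      apply filter_forall; intros; apply Sm. }
  apply Rmult_eq_reg_l with 2; [|lra]. rewrite <- D2, D. unfold b.
  rewrite (pow_add (-1) p 1), pow_1.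
  field. apply pow_nonzero. lra.
Qed.

Theorem theorem8 (p : nat) :
  is_series
    (fun n : nat => let k := INR (S n) in
       (-1) ^ n / ((4 * k - 1) * (4 * k) ^ (2 * p + 1) * (4 * k + 1)))
    (1 / 2 + sqrt 2 / 4 * ln (sqrt 2 - 1) - 1 / 4 * ln 2
     - 1 / 4 * sum_n_m (fun j : nat =>
         (1 - / 2 ^ (2 * j)) / 2 ^ (4 * j) * zeta (2 * j + 1)) 1 p)
  /\
  is_series
    (fun n : nat => let k := INR (S n) in
       (-1) ^ n / ((4 * k - 3) * (4 * k - 2) ^ (2 * p + 1) * (4 * k - 1)))
    (PI / 8 * (sqrt 2 - 1)
     - 1 / 2 * sum_n_m (fun j : nat =>
         (-1) ^ (j + 1) * PI ^ (2 * j + 1) / INR (Factorial.fact (2 * j + 1))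
         * bernoulli_poly (2 * j + 1) (1 / 4)) 1 p).
Proof.
  assert (Hk : forall n, 1 <= INR (S n)) by (intros n; apply (le_INR 1); lia).
  pose proof PI_RGT_0 as HPI.
  split.
  - change (1 / 4 * sum_n_m ?u 1 p) with (mult (1 / 4) (sum_n_m u 1 p)).
    rewrite <- (sum_n_m_mult_l (K:=R_Ring)).
    apply (is_series_pow_reduction (fun n => 4 * INR (S n))).
    + intros n. specialize (Hk n). lra.
    + exact is_series_4k.
    + intros j Hj.
      assert (H := is_series_scal_l (/ 4 ^ (2 * j + 1)) _ _ (is_series_eta (2 * j + 1) ltac:(lia))).
      assert (P2 : 2 ^ (2 * j) <> 0) by (apply pow_nonzero; lra).
      replace (mult (1 / 4) _)
        with (/ 4 ^ (2 * j + 1) * ((1 - 2 / 2 ^ (2 * j + 1)) * zeta (2 * j + 1))).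
      * revert H. apply is_series_ext. intros n. specialize (Hk n).
        rewrite Rpow_mult_distr. as_real_eq. cbn -[pow INR]. field.
        split; apply pow_nonzero; lra.
      * replace (4 ^ (2 * j + 1)) with (4 * 2 ^ (4 * j)).
        2:{ transitivity ((2 ^ 2) ^ (2 * j + 1)); [|f_equal; ring].
            rewrite <- pow_mult.
            replace (2 * (2 * j + 1))%nat with (2 + 4 * j)%nat by lia.
            rewrite pow_add. ring. }
        assert (P4 : 2 ^ (4 * j) <> 0) by (apply pow_nonzero; lra).
        rewrite pow_add, pow_1. unfold mult; cbn -[pow INR Nat.mul]. field. now split.
  - change (1 / 2 * sum_n_m ?u 1 p) with (mult (1 / 2) (sum_n_m u 1 p)).
    rewrite <- (sum_n_m_mult_l (K:=R_Ring)).
    generalize (is_series_pow_reduction (fun n => 4 * INR (S n) - 2)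
      (fun j => mult (1 / 2) ((-1) ^ (j + 1) * PI ^ (2 * j + 1) / INR (Factorial.fact (2 * j + 1))
         * bernoulli_poly (2 * j + 1) (1 / 4))) (PI / 8 * (sqrt 2 - 1))).
    intros R_. refine (is_series_ext _ _ _ _ (R_ _ is_series_4k2 _ p)); clear R_.
    + intros n. cbv zeta beta. f_equal. f_equal; [f_equal|]; ring.
    + intros n. specialize (Hk n). lra.
    + intros j _. rewrite bernoulli_poly_odd_quarter.
      assert (H := is_series_scal_l (/ 2 ^ (2 * j + 1)) _ _ (is_series_dirichlet_beta j)).
      replace (mult (1 / 2) _)
        with (/ 2 ^ (2 * j + 1) * dirichlet_beta (2 * j + 1)).
      * revert H. apply is_series_ext. intros n. specialize (Hk n).
        rewrite S_INR in *. replace (4 * (INR n + 1) - 2) with (2 * (2 * INR n + 1)) by ring.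
        rewrite Rpow_mult_distr. as_real_eq. cbn -[pow INR]. field.
        split; apply pow_nonzero; lra.
      * rewrite Rpow_mult_distr. unfold mult; cbn -[pow INR Nat.mul Factorial.fact].
        (* The sign in the statement meets the equal sign of the Bernoulli value; factorials and
           powers of [PI] cancel as well. *)
        assert (S1 : (-1) ^ (j + 1) * (-1) ^ (j + 1) = 1)
          by (rewrite <- Rpow_mult_distr; replace (-1 * -1) with 1 by ring; apply pow1).
        assert (P1 : PI ^ (2 * j + 1) <> 0) by (apply pow_nonzero; lra).
        assert (P2 : 2 ^ (2 * j + 1) <> 0) by (apply pow_nonzero; lra).
        assert (P3 : INR (Factorial.fact (2 * j + 1)) <> 0) by apply INR_fact_neq_0.
        revert S1 P1 P2 P3.
        generalize ((-1) ^ (j + 1)) (PI ^ (2 * j + 1)) (2 ^ (2 * j + 1))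
          (INR (Factorial.fact (2 * j + 1))) (dirichlet_beta (2 * j + 1)).
        intros s x y z w S1 P1 P2 P3.
        transitivity (s * s * w / y); [rewrite S1|]; field; auto.
Qed.
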